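(* Consider the two-way dynamic matching model described in the context, suppose it satisfies the GPG condition with parameter $\epsilon$, and suppose the graph $(\mathcal A,\mathcal M_+)$ is connected and acyclic (a tree). Let $r$ be the unique under-demanded type, let $d_r$ be the depth of the tree rooted at $r$, and let $\mathbf{TTP}$ be the truncated tree priority policy described in the context. Then there is an absolute constant $C>0$ such that for every $T\ge1$, $$\mathrm{Regret}(\mathbf{TTP},T)\le C\, r_{\max}\cdot\frac{n^2 d_r^2}{\epsilon}.$$
   Context: Model. There are $n$ agent types $\mathcal A=\{1,\dots,n\}$ and a finite set $\mathcal M$ of match types; each match $m$ consists of exactly two distinct types and yields reward $r_m>0$; $M\in\{0,1\}^{\mathcal A\times\mathcal M}$ with $M_{im}=1$ iff $m$ involves $i$; $m(i,j)$ denotes the match containing $i$ and $j$. In each discrete period exactly one agent arrives, of type $i$ with probability $\lambda_i>0$ independently ($\sum_i\lambda_i=1$); $A_i(t)$ counts type-$i$ arrivals up to $t$. After the arrival, matches can be performed if a waiting agent of each involved type is present; matched agents leave. $D_m(t)$ counts performances of $m$ up to $t$; $Q_i(t)$ is the number of waiting type-$i$ agents after period $t$, $Q(0)=0$. A truncated queue discards any arriving agent not matched in its arrival period. Regret: $\mathcal R^\Pi(t)=\mathbb E[r^\top D(t)]$, $\mathcal R^*(t)=\mathbb E[\max\{r^\top y: My\le A(t), y\in\mathbb Z^{\mathcal M}_{\ge0}\}]$, $\mathrm{Regret}(\Pi,T)=\sup_{0\le t\le T}(\mathcal R^*(t)-\mathcal R^\Pi(t))$. GPG: $\mathrm{SPP}(\lambda)$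 = maximize $r^\top z$ s.t. $Mz+s=\lambda$, $z,s\ge0$. GPG holds if it has a non-degenerate optimal basic solution $(z^*,s^* )$; $\epsilon=\min(\min_{z^*_m>0}z^*_m,\min_{s^*_i>0}s^*_i)$; $\mathcal M_+=\{m:z^*_m>0\}$, $\mathcal A_+=\{i:s^*_i>0\}$, $\mathcal A_0=\mathcal A\setminus\mathcal A_+$, $r_{\max}=\max_{m\in\mathcal M_+}r_m$. When $(\mathcal A,\mathcal M_+)$ is a tree, it is known that $\mathcal A_+=\{r\}$ for a single type $r$; the tree is rooted at $r$. Static priority policy: for each type $i$, a subset $\mathcal M(i)$ of matches in $\mathcal M_+$ containing $i$ and a strict order $\succ_i$ on it; upon arrival of a type-$i$ agent, it performs the $\succ_i$-highest match in $\mathcal M(i)$ whose other type has a non-empty queue, if any; otherwise the agent joins queue $i$ (discarded if queue $i$ is truncated). The queue of $r$ is truncated. $\mathbf{TTP}$: the static priority policy with $\mathcal M(i)=\{m(i,j): j \text{ a child of } i\}$ and $\succ_i$ an arbitrary strict order on it; in particular an arriving agent is never matched with its parent type. *)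

(* Defs.v *)
From HB Require Import structures.
From mathcomp Require Import all_boot all_order all_algebra.
From mathcomp Require Import all_classical all_reals all_analysis.

Set Implicit Arguments.
Unset Strict Implicit.
Unset Printing Implicit Defensive.

Import Order.TTheory GRing.Theory Num.Theory.

Local Open Scope ring_scope.

(* The agent types are the elements of 'I_n.  [ends m] is the set of the two  *)
(* types involved in the match m, so M_(i, m) = 1 iff i \in ends m.           *)
(* Two distinct matches are allowed to have the same ends.                    *)
Record matching_model (R : realType) (n : nat) := MatchingModel {
  match_type : finType;
  ends : match_type -> {set 'I_n};
  reward : match_type -> R;
  rate : 'I_n -> R;
  card_ends : forall m, #|ends m| = 2;
  reward_gt0 : forall m, 0 < reward m;
  rate_gt0 : forall i, 0 < rate i;
  rate_sum1 : \sum_i rate i = 1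
}.

Section StaticPlanning.
Context {R : realType} {n : nat} (G : matching_model R n).
Local Notation Mt := (match_type G).

Definition spp_feasible (z : Mt -> R) (s : 'I_n -> R) : Prop :=
  [/\ forall i, \sum_(m | i \in ends m) z m + s i = rate G i,
      forall m, 0 <= z m
    & forall i, 0 <= s i].

Definition spp_optimal (z : Mt -> R) (s : 'I_n -> R) : Prop :=
  spp_feasible z s /\
  forall z' s', spp_feasible z' s' ->
    \sum_m reward m * z' m <= \sum_m reward m * z m.

(* Columns of the constraint matrix [M | I] of the standard form             *)
(* M z + s = lambda; the variables are indexed by Mt + 'I_n.                 *)
Definition spp_column (v : Mt + 'I_n) : 'cV[R]_n :=
  match v with
  | inl m => \col_i (i \in ends m)%:R
  | inr j => \col_i (i == j)%:R
  end.

Definition spp_var (z : Mt -> R) (s : 'I_n -> R) (v : Mt + 'I_n) : R :=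
  match v with inl m => z m | inr i => s i end.

Definition spp_basis (B : {set Mt + 'I_n}) : Prop :=
  basis_of fullv [seq spp_column v | v <- enum B].

Definition nondegenerate_basic_solution (z : Mt -> R) (s : 'I_n -> R) : Prop :=
  exists B : {set Mt + 'I_n},
    [/\ spp_basis B,
        forall v, v \notin B -> spp_var z s v = 0
      & forall v, v \in B -> spp_var z s v != 0].

Definition gpg_solution (z : Mt -> R) (s : 'I_n -> R) : Prop :=
  spp_optimal z s /\ nondegenerate_basic_solution z s.

Definition active_matches (z : Mt -> R) : {set Mt} := [set m | 0 < z m].

Definition under_demanded (s : 'I_n -> R) : {set 'I_n} := [set i | 0 < s i].

(* The infimum of a finite set of positive reals, which is nonempty as soon  *)
(* as (z, s) is feasible: the minimum of the two minima, where the minimum   *)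
(* over an empty family is ignored.                                          *)
Definition gpg_eps (z : Mt -> R) (s : 'I_n -> R) : R :=
  inf ([set z m | m in [set m | 0 < z m]] `|`
       [set s i | i in [set i | 0 < s i]])%classic.

(* Rewards are positive, so the default value 0 only matters when M_+ is     *)
(* empty, i.e. (for a connected graph) when there is a single type.          *)
Definition max_reward (z : Mt -> R) : R :=
  \big[Num.max/0]_(m in active_matches z) reward m.

Definition match_adj (z : Mt -> R) : rel 'I_n :=
  fun i j => [exists m in active_matches z, ends m == [set i; j]].

End StaticPlanning.

Section Trees.
Context {n : nat} (e : rel 'I_n).

Definition graph_connected : Prop := forall i j, connect e i j.

(* For a symmetric irreflexive e, the simple closed walks with at most two   *)
(* vertices are not cycles.                                                  *)
Definition graph_acyclic : Prop :=
  forall c : seq 'I_n, ucycle e c -> (size c <= 2)%N.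

Definition is_tree : Prop := graph_connected /\ graph_acyclic.

(* Least k such that there is a walk with k edges from i to j (n if there is *)
(* no such walk).                                                            *)
Definition graph_dist (i j : 'I_n) : nat :=
  find (fun k => [exists p : k.-tuple 'I_n, path e i p && (last i p == j)])
       (iota 0 n).

Definition tree_depth (root : 'I_n) : nat := \max_i graph_dist root i.

(* is_child root i j: j is a child of i in the tree rooted at root.          *)
Definition is_child (root i j : 'I_n) : bool :=
  e i j && (graph_dist root j == (graph_dist root i).+1).

End Trees.

Section Dynamics.
Context {R : realType} {n : nat} (G : matching_model R n).
Local Notation Mt := (match_type G).

(* sp_order i m m' means that m has priority over m' for the arrivals of     *)
(* type i.                                                                   *)
Record static_policy := StaticPolicy {
  sp_matches : 'I_n -> {set Mt};
  sp_order : 'I_n -> rel Mt;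
  sp_truncated : {set 'I_n}
}.

Definition strict_order_on (A : {set Mt}) (o : rel Mt) : Prop :=
  [/\ {in A, forall m, ~~ o m m},
      {in A & &, transitive o}
    & {in A &, forall m m', m != m' -> o m m' || o m' m}].

Definition static_priority (z : Mt -> R) (pi : static_policy) : Prop :=
  forall i,
    [/\ sp_matches pi i \subset active_matches z,
        {in sp_matches pi i, forall m, i \in ends m}
      & strict_order_on (sp_matches pi i) (sp_order pi i)].

Definition truncated_tree_priority (z : Mt -> R) (root : 'I_n)
    (pi : static_policy) : Prop :=
  [/\ static_priority z pi,
      sp_truncated pi = [set root]
    & forall i, sp_matches pi i =
        [set m in active_matches z |
          [exists j, is_child (match_adj z) root i j &&
                     (ends m == [set i; j])]]].

(* Queue lengths Q and numbers D of performed matches.                       *)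
Record state := State {
  queue : 'I_n -> nat;
  performed : Mt -> nat
}.

Definition init_state : state := State (fun=> 0%N) (fun=> 0%N).

Definition available (Q : 'I_n -> nat) (i : 'I_n) (m : Mt) : bool :=
  [forall j in ends m :\ i, (0 < Q j)%N].

Definition highest_match (pi : static_policy) (Q : 'I_n -> nat) (i : 'I_n) :
    option Mt :=
  [pick m in sp_matches pi i | available Q i m &&
    [forall m' in sp_matches pi i,
      (available Q i m' && (m' != m)) ==> sp_order pi i m m']].

Definition step (pi : static_policy) (S : state) (i : 'I_n) : state :=
  match highest_match pi (queue S) i with
  | Some m => State (fun j => (queue S j - (j \in ends m :\ i))%N)
                    (fun m' => (performed S m' + (m' == m))%N)
  | None => if i \in sp_truncated pi then S
            else State (fun j => (queue S j + (j == i))%N) (performed S)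
  end.

(* a k is the type of the agent arriving in period k + 1.                    *)
Fixpoint state_at (pi : static_policy) (a : nat -> 'I_n) (t : nat) : state :=
  if t is t'.+1 then step pi (state_at pi a t') (a t') else init_state.

Definition arrivals (a : nat -> 'I_n) (t : nat) (i : 'I_n) : nat :=
  \sum_(k < t) (a k == i).

Definition online_reward (pi : static_policy) (a : nat -> 'I_n) (t : nat) : R :=
  \sum_m reward m * (performed (state_at pi a t) m)%:R.

(* The set is finite and nonempty, so the supremum is a maximum.             *)
Definition offline_reward (a : nat -> 'I_n) (t : nat) : R :=
  sup [set \sum_m reward m * (y m)%:R | y in
        [set y : Mt -> nat | forall i : 'I_n,
          (\sum_(m | i \in ends m) y m <= arrivals a t i)%N]]%classic.

Section Regret.
Context {d : measure_display} {Omega : measurableType d}.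
Context (P : probability Omega R) (a : nat -> Omega -> 'I_n).

Definition iid_arrivals : Prop :=
  [/\ forall k i, measurable [set w | a k w = i]%classic,
      forall k i, P [set w | a k w = i]%classic = (rate G i)%:E
    & forall (s : seq nat) (x : nat -> 'I_n), uniq s ->
        P [set w | forall k, k \in s -> a k w = x k]%classic =
        (\prod_(k <- s) P [set w | a k w = x k]%classic)%E].

Definition regret (pi : static_policy) (T : nat) : \bar R :=
  ereal_sup
    [set ('E_P[fun w => offline_reward (a^~ w) t] -
          'E_P[fun w => online_reward pi (a^~ w) t])%E
    | t in [set t : nat | (t <= T)%N]]%classic.

End Regret.
End Dynamics.

(* Main.v *)
Require Import Defs.
From mathcomp Require Import all_boot all_order all_algebra.
From mathcomp Require Import all_classical all_reals all_analysis.
From mathcomp Require Import ring lra zify.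

(** Complementary slackness bounds the regret by the dual prices of the waiting
    agents, hence by [r_max] times the expected total queue length. Let [T] sum
    a function over the children of a type and let [F] solve [F + T F = T Q], so
    that [F] is the alternating sum of the queues over the levels below a type.
    Every arrival of [a] changes [F] by the increment [- (1 + T)^-1 e_a] of a
    free walk whose drift at [i] is minus the flow towards the parent of [i],
    except that [F a] does not decrease when [a] finds no waiting child; then
    [T Q] vanishes at [a], so that [F a] is at most the sum of [F] over the
    grandchildren of [a]. Hence [F <= (1 - T^2)^-1 M], where the [M_q] are
    independent-increment walks reflected at 0, with increments
    [(T e_a - e_a) q], recentered to have drift [- eps / n]. Then
    [T Q = F + T F <= (1 - T)^-1 M <= sum_q M_q]. The mean of a reflected walk
    started at 0 is nondecreasing in time, so the drift of its square bounds it
    at every time by the variance over the drift; the variances sum to a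
    constant. *)

Set Implicit Arguments.
Unset Strict Implicit.
Unset Printing Implicit Defensive.

Import Order.TTheory GRing.Theory Num.Theory.

Local Open Scope ring_scope.

(** * Linear recursions on a rooted tree *)

Section RootedTree.
Context {R : realType} {n : nat}.
Variables (root : 'I_n) (par : 'I_n -> 'I_n) (dep : 'I_n -> nat).
Hypothesis dep_par : forall i, i != root -> dep i = (dep (par i)).+1.
Hypothesis dep_lt : forall i, (dep i < n)%N.

Definition child (p c : 'I_n) : bool := (c != root) && (par c == p).

Definition child_sum (f : 'I_n -> R) (p : 'I_n) : R := \sum_(c | child p c) f c.
Local Notation T := child_sum.

Lemma dep_child p c : child p c -> dep c = (dep p).+1.
Proof. by case/andP=> cr /eqP <-; exact: dep_par. Qed.

Lemma child_irrefl p : child p p = false.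
Proof. by apply/negP => /dep_child /n_Sn. Qed.

Lemma child_sumD f g : T (f \+ g) = T f \+ T g.
Proof. by apply/funext => p; rewrite /T big_split. Qed.

Lemma child_sumZ k f : T (fun i => k * f i) = fun p => k * T f p.
Proof. by apply/funext => p; rewrite /T mulr_sumr. Qed.

Lemma child_sumN f : T (fun i => - f i) = fun p => - T f p.
Proof. by apply/funext => p; rewrite /T sumrN. Qed.

Lemma child_sumB f g : T (f \- g) = T f \- T g.
Proof. by apply/funext => p; rewrite /T sumrB. Qed.

Lemma le_child_sum f g p : (forall c, child p c -> f c <= g c) -> T f p <= T g p.
Proof. by move=> h; apply: ler_sum. Qed.

Lemma child_sum_ge0 f : (forall i, 0 <= f i) -> forall p, 0 <= T f p.
Proof. by move=> h p; apply: sumr_ge0. Qed.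

(** Induction from the leaves up: depths stay below [n], so [n - dep p] shrinks on the way down. *)
Lemma tree_ind (P : 'I_n -> Prop) :
  (forall p, (forall c, (dep p < dep c)%N -> P c) -> P p) -> forall p, P p.
Proof.
move=> IH p; have [k] := ubnP (n - dep p).
elim: k p => // k IHk p; rewrite ltnS => hk; apply: IH => c hc; apply: IHk.
by apply: leq_trans hk; apply: ltn_sub2l => //; exact: dep_lt.
Qed.

Fixpoint neumann_fuel (s : R) (f : 'I_n -> R) (k : nat) : 'I_n -> R :=
  if k is k'.+1 then f \+ (fun p => s * T (neumann_fuel s f k') p)
  else fun=> 0.

(* [neumann s f] is the solution of [g = f + s * T g], i.e. (1 - s T)^-1 f;  *)
(* T is nilpotent because it moves values one level up.                      *)
Definition neumann s f := neumann_fuel s f n.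

Lemma neumann_fuelS s f k p : (n <= dep p + k)%N ->
  neumann_fuel s f k.+1 p = neumann_fuel s f k p.
Proof.
elim: k p => [|k IH] p hk; first by move: hk; rewrite addn0 leqNgt dep_lt.
rewrite [LHS]/= [RHS]/=; congr (_ + s * _); apply: eq_bigr => c /dep_child hc.
by apply: IH; rewrite hc addSnnS.
Qed.

Lemma neumannE s f : neumann s f = f \+ (fun p => s * T (neumann s f) p).
Proof.
by apply/funext => p; rewrite {1}/neumann -neumann_fuelS // leq_addl.
Qed.

(** Respectively [(1 + T)^-1], [(1 - T)^-1] (sum over all descendants) and [(1 - T^2)^-1]
    (descendants at even distance). *)
Definition alt_solve f := neumann (-1) f.
Definition subtree_sum f := neumann 1 f.
Definition even_sum f := alt_solve (subtree_sum f).
Local Notation J := alt_solve.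
Local Notation H := subtree_sum.
Local Notation B := even_sum.

Lemma alt_solveE f p : J f p + T (J f) p = f p.
Proof. by rewrite {1}/J neumannE /=; rewrite -/(J f); ring. Qed.

Lemma subtree_sumE f p : H f p = f p + T (H f) p.
Proof. by rewrite {1}/H neumannE /= mul1r. Qed.

Lemma even_sum_subtree f p : B f p + T (B f) p = H f p.
Proof. exact: alt_solveE. Qed.

Lemma even_sumE f p : B f p = f p + T (T (B f)) p.
Proof.
have E : B f \+ T (B f) = H f by apply/funext => q; exact: even_sum_subtree.
have := subtree_sumE f p; rewrite -E child_sumD /=; lra.
Qed.

(** Minimum principle for [1 - T^2]; comparisons of even sums reduce to it. *)
Lemma ge0_even_step f :
  (forall p, T (T f) p <= f p) -> forall p, 0 <= f p.
Proof.
move=> h; apply: tree_ind => p IH; apply: le_trans (h p).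
apply: sumr_ge0 => c /dep_child hc; apply: sumr_ge0 => g /dep_child hg.
by apply: IH; rewrite hg hc ltnS leqW.
Qed.

(** Lets identities for [net_flow] be checked after applying [1 + T] to both sides. *)
Lemma alt_uniq f : (forall p, f p + T f p = 0) -> forall p, f p = 0.
Proof.
move=> h; apply: tree_ind => p IH; have := h p.
rewrite [T f p]big1 ?addr0 // => c /dep_child hc.
by apply: IH; rewrite hc.
Qed.

Lemma even_sum_ge0 f : (forall i, 0 <= f i) -> forall p, 0 <= B f p.
Proof.
by move=> h; apply: ge0_even_step => p; rewrite [leRHS]even_sumE lerDr.
Qed.

Lemma subtree_sum_ge0 f : (forall i, 0 <= f i) -> forall p, 0 <= H f p.
Proof.
move=> h; apply: tree_ind => p IH; rewrite subtree_sumE addr_ge0 //.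
by apply: sumr_ge0 => c /dep_child hc; apply: IH; rewrite hc.
Qed.

Lemma sum_child_sum f : \sum_p T f p = \sum_(i | i != root) f i.
Proof.
rewrite /T (exchange_big_dep (fun c => c != root)) /=; last first.
  by move=> p c _ /andP[].
apply: eq_bigr => c cr; rewrite (eq_bigl (pred1 (par c))) ?big_pred1_eq // => p.
by rewrite /child cr /= eq_sym.
Qed.

Lemma sum_depth_child_sum f k :
  \sum_(p | dep p == k) T f p = \sum_(c | (dep c == k.+1) && (c != root)) f c.
Proof.
rewrite /T (exchange_big_dep (fun c => (dep c == k.+1) && (c != root))) /=.
  apply: eq_bigr => c /andP[/eqP dc cr].
  rewrite (eq_bigl (pred1 (par c))) ?big_pred1_eq // => p.
  rewrite /child cr /= [RHS]eq_sym andbC.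
  case: (par c =P p) => [<-|//] /=; by rewrite -eqSS -dep_par // dc eqxx.
by move=> p c /eqP <- /[dup] /dep_child -> /andP[-> _]; rewrite eqxx.
Qed.

(** Subtrees rooted at a common depth are disjoint; the induction goes from the deepest level
    upwards. *)
Lemma sum_depth_subtree_sum f k : (forall i, 0 <= f i) ->
  \sum_(p | dep p == k) H f p <= \sum_(q | (k <= dep q)%N) f q.
Proof.
move=> f0; have [m] := ubnP (n - k); elim: m k => // m IH k; rewrite ltnS => hm.
under eq_bigr do rewrite subtree_sumE.
rewrite big_split /= sum_depth_child_sum.
have [nk|kn] := leqP n k.
  have e0 j i : (n <= j)%N -> (dep i == j) = false.
    by move=> nj; rewrite ltn_eqF // (leq_trans (dep_lt i)).
  rewrite [X in X + _]big_pred0 => [|i]; last exact: e0.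
  rewrite add0r [leLHS]big_pred0 => [|i]; last by rewrite e0 // leqW.
  exact: sumr_ge0.
have /IH le : (n - k.+1 < m)%N by lia.
rewrite [leRHS](bigID (fun q => dep q == k)) /=; apply: lerD.
  rewrite le_eqVlt; apply/orP; left; apply/eqP; apply: eq_bigl => q.
  by case: eqP => [->|]; rewrite ?leqnn ?andbF.
apply: le_trans (le_trans le _); last first.
  rewrite le_eqVlt; apply/orP; left; apply/eqP; apply: eq_bigl => q.
  by rewrite ltn_neqAle eq_sym andbC.
rewrite [leRHS](bigID (fun c => c != root)) /= lerDl sumr_ge0 // => i _.
exact: subtree_sum_ge0.
Qed.

Lemma subtree_sum_le f p : (forall i, 0 <= f i) -> H f p <= \sum_q f q.
Proof.
move=> f0; apply: le_trans (_ : \sum_(q | dep q == dep p) H f q <= _).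
  by rewrite (bigD1 p) //= lerDl sumr_ge0 // => i _; exact: subtree_sum_ge0.
apply: le_trans (sum_depth_subtree_sum _ f0) _.
rewrite [leRHS](bigID (fun q => (dep p <= dep q)%N)) /= lerDl.
by rewrite sumr_ge0.
Qed.

Lemma even_sum_le f p : (forall i, 0 <= f i) -> B f p <= \sum_q f q.
Proof.
move=> f0; apply: le_trans (subtree_sum_le p f0).
rewrite -even_sum_subtree lerDl; apply: child_sum_ge0.
exact: even_sum_ge0.
Qed.

Definition unit_at (a p : 'I_n) : R := (p == a)%:R.
Local Notation e := unit_at.

Lemma child_sum_unit c p : T (e c) p = (child p c)%:R.
Proof.
rewrite /T /e; case: (boolP (child p c)) => hc.
  by rewrite (bigD1 c) //= eqxx big1 ?addr0 // => i /andP[_ /negbTE ->].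
by rewrite big1 // => i hi; case: eqP hi hc => // -> ->.
Qed.

(* An agent of the root type that is not matched is discarded: this is       *)
(* [StepJoin] with [a = root], where [q' = q].                               *)
Inductive tree_step (q : 'I_n -> R) (a : 'I_n) (q' : 'I_n -> R) : Prop :=
| StepMatch c of child a c & q' = q \- e c
| StepJoin of (forall c, child a c -> q c = 0) &
              q' = q \+ (fun p => (a != root)%:R * e a p).

(** The operator [T (1 + T)^-1]: children minus grandchildren plus the next level, and so on. *)
Definition net_flow q := T (J q).

Lemma net_flowE q p : net_flow q p + T (net_flow q) p = T q p.
Proof.
have E : J q \+ T (J q) = q by apply/funext => i; exact: alt_solveE.
by rewrite -[in RHS]E child_sumD.
Qed.

(** As [T e_c = e_a] for every child [c] of [a], any choice of the matched child gives the same
    change. *)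
Lemma net_flow_match q a q' c p : child a c -> q' = q \- e c ->
  net_flow q' p = net_flow q p - J (e a) p.
Proof.
move=> ac ->; apply/eqP; rewrite -subr_eq0; apply/eqP.
apply: (alt_uniq (f := net_flow (q \- e c) \- (net_flow q \- J (e a)))) => i.
rewrite !child_sumB /=.
have := net_flowE (q \- e c) i; rewrite child_sumB /= child_sum_unit.
have := net_flowE q i; have := alt_solveE (e a) i; rewrite {2}/e.
have -> : child i c = (i == a).
  by move: ac; rewrite /child => /andP[-> /eqP ->]; rewrite eq_sym.
lra.
Qed.

(** [T (1 + T)^-1 e_a = e_a - (1 + T)^-1 e_a]. For a discarded root agent the two corrections
    cancel, since [T e_root = 0]. *)
Lemma net_flow_join q a q' p :
    q' = q \+ (fun p => (a != root)%:R * e a p) ->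
  net_flow q' p = net_flow q p - J (e a) p + e a p.
Proof.
move=> ->; apply/eqP; rewrite -subr_eq0; apply/eqP.
set q2 := _ \+ _.
apply: (alt_uniq (f := net_flow q2 \- (net_flow q \- J (e a) \+ e a))) => i.
rewrite child_sumB /= child_sumD child_sumB /=.
have := net_flowE q2 i; rewrite [in X in _ = X]child_sumD /= child_sumZ.
rewrite child_sum_unit /child.
have := net_flowE q i; have := alt_solveE (e a) i.
by case: (a != root) => /=; lra.
Qed.

(** * One-step comparison of the net flow with reflected walks *)

Section FlowBound.
Variables (lam zt : 'I_n -> R) (k : R).
Hypothesis k_ge0 : 0 <= k.
Hypothesis lamE : forall i, zt i + T zt i = lam i.
Hypothesis zt_ge : forall i, k * n%:R <= zt i.

Definition walk_step (a q : 'I_n) : R := T (e a) q - e a q - (T lam q - lam q) - k.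

(* W = B m' - B m + J e_a - zt + k B 1 satisfies W >= T^2 W.                 *)
Lemma even_sum_step a m m' : (forall q, m q + walk_step a q <= m' q) ->
  forall p, B m p - J (e a) p <= B m' p.
Proof.
move=> hm p.
pose W := B m' \- B m \+ J (e a) \- zt \+ (fun i => k * B (fun=> 1) i).
have W0 : 0 <= W p.
  apply: ge0_even_step => i; rewrite /W.
  do !rewrite ?child_sumB ?child_sumD ?child_sumN ?child_sumZ /=.
  have := even_sumE m' i; have := even_sumE m i.
  have := congr1 (fun x => k * x) (even_sumE (fun=> 1) i) => /=; rewrite mulrDr.
  have TJ : T (J (e a)) \+ J (e a) = e a.
    by apply/funext => x /=; rewrite addrC alt_solveE.
  have Tz : T zt \+ zt = lam by apply/funext => x /=; rewrite addrC lamE.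
  have := congr1 (fun f => T f i) TJ; rewrite child_sumD /=.
  have := congr1 (fun f => T f i) Tz; rewrite child_sumD /=.
  have := lamE i; have := alt_solveE (e a) i.
  have := hm i; rewrite /walk_step; lra.
(* The drift costs at most [k * n], which the flow [zt p] absorbs. *)
have : k * B (fun=> 1) p <= k * n%:R.
  apply: ler_wpM2l => //; apply: le_trans (even_sum_le _ _) _ => //.
  by rewrite sumr_const card_ord.
move: W0 (zt_ge p); rewrite /W /=; lra.
Qed.

(** The net flow moves by exactly [- J (e a)], which [even_sum_step] handles, except at [a] itself
    when it joins. *)
Lemma net_flow_le_step a q q' m m' :
  tree_step q a q' -> (forall i, 0 <= q' i) -> (forall i, 0 <= m' i) ->
  (forall i, m i + walk_step a i <= m' i) ->
  (forall p, net_flow q p <= B m p) -> forall p, net_flow q' p <= B m' p.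
Proof.
move=> st q0 m0 hm IH.
have base p : net_flow q p - J (e a) p <= B m' p.
  by apply: le_trans (even_sum_step hm p); rewrite lerD2r.
case: st => [c ac hq|empty hq] p; first by rewrite (net_flow_match p ac hq).
have off i : i != a -> net_flow q' i <= B m' i.
  move=> ia; apply: le_trans (base i); rewrite (net_flow_join i hq).
  by rewrite /e (negbTE ia) addr0.
have [->|/off//] := eqVneq p a.
(* a arrived and found no waiting child, so T q' a = 0 and the bound comes   *)
(* from the grandchildren of a.                                              *)
have Tq0 : T q' a = 0.
  apply: big1 => c ac; rewrite hq /= (empty c ac) /e.
  by case: (c =P a) ac => [->|]; rewrite ?child_irrefl //= mulr0 addr0.
(* Queues are nonnegative, so [net_flow q' + T (net_flow q') >= 0] at each child of [a]. *)
have : T (net_flow q') a >= - T (T (net_flow q')) a.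
  have -> : - T (T (net_flow q')) a = T (fun i => -1 * T (net_flow q') i) a.
    by rewrite child_sumZ mulN1r.
  apply: le_child_sum => c _; have := net_flowE q' c.
  have := child_sum_ge0 q0 c; lra.
(* Grandchildren lie two levels below [a], hence differ from [a], and [off] applies. *)
have : T (T (net_flow q')) a <= T (T (B m')) a.
  apply: le_child_sum => c ac; apply: le_child_sum => g cg; apply: off.
  apply/eqP => ga; move: (dep_child cg) (dep_child ac); rewrite ga => -> /eqP.
  by rewrite -addn1 -[in X in _ == X]addn1 => /eqP; lia.
have := even_sumE m' a; have := net_flowE q' a; have := m0 a; lra.
Qed.

(** Each agent outside the root is counted once, at its parent; at each of the [n] types,
    [T q = F + T F <= (1 - T)^-1 m] with [F = net_flow q]. *)
Lemma sum_queue_le q m : (forall i, 0 <= q i) -> (forall i, 0 <= m i) ->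
  (forall p, net_flow q p <= B m p) ->
  \sum_(i | i != root) q i <= n%:R * \sum_i m i.
Proof.
move=> q0 m0 h; rewrite -sum_child_sum.
have -> : n%:R * \sum_i m i = \sum_(p < n) \sum_i m i.
  by rewrite sumr_const card_ord mulr_natl.
apply: ler_sum => p _; apply: le_trans (subtree_sum_le p m0).
rewrite -net_flowE -even_sum_subtree lerD //; exact: le_child_sum.
Qed.

End FlowBound.
End RootedTree.

(** * Independent arrivals and reflected walks *)

Section IidMean.
Context {R : realType} {I : finType}.
Variable lam : I -> R.
Hypothesis lam_ge0 : forall i, 0 <= lam i.
Hypothesis lam_sum1 : \sum_i lam i = 1.

(** Expectation of [h] over words of [t] independent letters of law [lam], splitting off the first
    letter. *)
Fixpoint iid_mean (t : nat) (h : seq I -> R) : R :=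
  if t is t'.+1 then \sum_i lam i * iid_mean t' (fun s => h (i :: s))
  else h [::].

Lemma iid_mean_tuple t h :
  iid_mean t h = \sum_(w : t.-tuple I) (\prod_(i <- w) lam i) * h w.
Proof.
elim: t h => [|t IH] h /=.
  rewrite (big_pred1 [tuple]) => [|w]; first by rewrite big_nil mul1r.
  by rewrite [w]tuple0 /= eqxx.
under eq_bigr do rewrite IH mulr_sumr.
rewrite pair_bigA /=.
rewrite [RHS](reindex (fun p : I * t.-tuple I => [tuple of p.1 :: p.2])) /=.
  by apply: eq_bigr => p _; rewrite big_cons mulrA.
exists (fun w => (thead w, [tuple of behead w])) => [[i w] _|w _] /=.
  by congr pair; apply/val_inj.
by rewrite [RHS]tuple_eta.
Qed.

Lemma le_iid_mean t h1 h2 : (forall s, size s = t -> h1 s <= h2 s) ->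
  iid_mean t h1 <= iid_mean t h2.
Proof.
elim: t h1 h2 => [|t IH] h1 h2 eh /=; first exact: eh.
apply: ler_sum => i _; apply: ler_wpM2l => //.
by apply: IH => s st; rewrite eh //= st.
Qed.

Lemma iid_mean_cst t c : iid_mean t (fun=> c) = c.
Proof. by elim: t => //= t ->; rewrite -mulr_suml lam_sum1 mul1r. Qed.

Lemma iid_meanD t h1 h2 :
  iid_mean t (fun s => h1 s + h2 s) = iid_mean t h1 + iid_mean t h2.
Proof.
elim: t h1 h2 => //= t IH h1 h2; rewrite -big_split /=.
by apply: eq_bigr => i _; rewrite IH mulrDr.
Qed.

Lemma iid_meanZ t c h : iid_mean t (fun s => c * h s) = c * iid_mean t h.
Proof.
elim: t h => //= t IH h; rewrite mulr_sumr.
by apply: eq_bigr => i _; rewrite IH mulrCA.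
Qed.

Lemma iid_mean_sum t (J : finType) (h : J -> seq I -> R) :
  iid_mean t (fun s => \sum_j h j s) = \sum_j iid_mean t (h j).
Proof.
elim: t h => //= t IH h; rewrite exchange_big /=.
by apply: eq_bigr => i _; rewrite IH mulr_sumr.
Qed.

Lemma iid_mean_rcons t h :
  iid_mean t.+1 h = iid_mean t (fun s => \sum_i lam i * h (rcons s i)).
Proof.
elim: t h => [|t IH] h //.
rewrite -[LHS]/(\sum_i lam i * iid_mean t.+1 (fun s => h (i :: s))).
by under eq_bigr do rewrite IH.
Qed.

(** The Lindley recursion of queueing theory: a walk with increments [g] reflected at 0. *)
Definition lindley_step (g : I -> R) (x : R) (i : I) : R := Num.max 0 (x + g i).

Definition lindley g (s : seq I) : R := foldl (lindley_step g) 0 s.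

Lemma lindley_rcons g s i :
  lindley g (rcons s i) = Num.max 0 (lindley g s + g i).
Proof. by rewrite /lindley foldl_rcons. Qed.

Lemma lindley_ge0 g s : 0 <= lindley g s.
Proof.
by case/lastP: s => [|s i]; rewrite // lindley_rcons le_max lexx.
Qed.

(** The recursion is monotone in its starting value, and the extra first letter replaces the start 0
    by a nonnegative one. *)
Lemma lindley_cons_ge g s i : lindley g s <= lindley g (i :: s).
Proof.
rewrite /lindley /=; have : 0 <= lindley_step g 0 i by rewrite le_max lexx.
elim: s 0 (lindley_step g 0 i) => //= j s IH x y xy; apply: IH.
by rewrite /lindley_step ge_max !le_max lexx /= lerD2r xy orbT.
Qed.

Section Drift.
Variables (g : I -> R) (k v : R).
Hypothesis k_ge0 : 0 <= k.
Hypothesis g_mean : \sum_i lam i * g i = - k.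
Hypothesis g_var : \sum_i lam i * g i ^+ 2 <= v.
Local Notation m t := (iid_mean t (lindley g)).

Lemma lindley_mean_ge0 t : 0 <= m t.
Proof.
rewrite -(iid_mean_cst t 0); apply: le_iid_mean => s _; exact: lindley_ge0.
Qed.

(* Starting the reflected walk one step earlier can only raise it.           *)
Lemma lindley_mean_homo s t : (s <= t)%N -> m s <= m t.
Proof.
move=> /subnK <-; elim: (t - s)%N => // j IH; apply: le_trans IH _.
rewrite addSn /= -[leLHS]mul1r -lam_sum1 mulr_suml; apply: ler_sum => i _.
by apply: ler_wpM2l => //; apply: le_iid_mean => u _; exact: lindley_cons_ge.
Qed.

(** Reflection at 0 can only lower the square; the square of the free step is then expanded. *)
Lemma lindley_drift t :
  iid_mean t.+1 (fun s => lindley g s ^+ 2) <=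
  iid_mean t (fun s => lindley g s ^+ 2) - k *+ 2 * m t + v.
Proof.
rewrite iid_mean_rcons -mulNr -iid_meanZ -iid_meanD -[v](iid_mean_cst t).
rewrite -iid_meanD; apply: le_iid_mean => s _; set x := lindley g s.
apply: (@le_trans _ _ (\sum_i lam i * (x + g i) ^+ 2)).
  apply: ler_sum => i _; apply: ler_wpM2l => //.
  rewrite lindley_rcons -/x maxEle; case: ifP => _ //; rewrite expr0n; exact: sqr_ge0.
have -> : \sum_i lam i * (x + g i) ^+ 2 =
    x ^+ 2 * \sum_i lam i + x *+ 2 * \sum_i lam i * g i +
    \sum_i lam i * g i ^+ 2.
  rewrite !mulr_sumr -!big_split /=; apply: eq_bigr => i _; ring.
rewrite lam_sum1 g_mean; have := g_var; lra.
Qed.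

Lemma lindley_mean_cumul t : k *+ 2 * \sum_(0 <= j < t) m j <= t%:R * v.
Proof.
suff : iid_mean t (fun s => lindley g s ^+ 2) +
    k *+ 2 * \sum_(0 <= j < t) m j <= t%:R * v.
  apply: le_trans; rewrite lerDr -(iid_mean_cst t 0).
  by apply: le_iid_mean => s _; rewrite sqr_ge0.
elim: t => [|t IH].
  by rewrite big_nil /lindley /= expr0n mulr0 mul0r addr0.
rewrite big_nat_recr //= -natr1; have := lindley_drift t; move: IH => /=; lra.
Qed.

Lemma lindley_mean_le t : k * m t <= v.
Proof.
have v0 : 0 <= v.
  by apply: le_trans g_var; apply: sumr_ge0 => i _; rewrite mulr_ge0 ?sqr_ge0.
case: (posnP t) => [->|t0]; first by rewrite /lindley /= mulr0.
(* With horizon [2 t], the last [t] means are each at least [m t]; the factor 2 of the drift pays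
   for the doubled horizon. *)
have := lindley_mean_cumul (t + t).
rewrite (@big_cat_nat _ _ _ t) //= ?leq_addr // mulrDr.
have h1 : 0 <= k *+ 2 * \sum_(0 <= j < t) m j.
  rewrite mulr_ge0 ?mulrn_wge0 //; apply: sumr_ge0 => j _.
  exact: lindley_mean_ge0.
have h2 : t%:R * m t <= \sum_(t <= j < t + t) m j.
  have -> : t%:R * m t = \sum_(t <= j < t + t) m t.
    by rewrite sumr_const_nat addnK mulr_natl.
  rewrite big_nat [leRHS]big_nat; apply: ler_sum => j /andP[tj _].
  exact: lindley_mean_homo.
have h3 : k *+ 2 * (t%:R * m t) <= k *+ 2 * \sum_(t <= j < t + t) m j.
  by apply: ler_wpM2l => //; rewrite mulrn_wge0.
move=> h4; rewrite -(@ler_pM2l _ (t%:R *+ 2)) ?mulrn_wgt0 ?ltr0n //.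
move: h1 h3 h4; rewrite natrD; lra.
Qed.

End Drift.
End IidMean.

(** * Expectations of functions of finitely many arrivals *)

Section Prefix.
Context {R : realType} {d : measure_display} {Omega : measurableType d}.
Variable P : probability Omega R.

Lemma expectation_sum_indic (J : finType) (F : J -> set Omega) (c : J -> R) :
  (forall j, measurable (F j)) ->
  ('E_P[fun w => (\sum_j c j * \1_(F j) w)%R] =
   (\sum_j c j * fine (P (F j)))%R%:E)%E.
Proof.
move=> mF; rewrite unlock.
have int j : P.-integrable setT (fun w => (c j)%:E * (\1_(F j) w)%:E)%E.
  by apply: integrableZl => //; exact: integrable_indic.
under eq_integral do (rewrite -sumEFin; under eq_bigr do rewrite EFinM).
rewrite integral_sum // -sumEFin; apply: eq_bigr => j _.
rewrite integralZl //; last exact: integrable_indic.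
by rewrite integral_indic // setIT EFinM fineK // fin_num_measure.
Qed.

Variables (n : nat) (G : matching_model R n) (a : nat -> Omega -> 'I_n).
Hypothesis ia : iid_arrivals G P a.

(** Such a function is a finite combination of indicators of cylinders, whose probabilities factor
    by independence. *)
Lemma expectation_prefix t (h : seq 'I_n -> R) (x0 : 'I_n) :
  ('E_P[fun w => h (mkseq (a^~ w) t)] = (iid_mean (rate G) t h)%:E)%E.
Proof.
have [ma Pa ind] := ia.
pose F (x : t.-tuple 'I_n) :=
  [set w | forall k, k \in iota 0 t -> a k w = nth x0 x k]%classic.
have mF x : measurable (F x).
  have -> : F x = (\bigcap_(k in [set` iota 0 t])
      [set w | a k w = nth x0 x k])%classic.
    by apply/seteqP; split => w Fw k; exact: Fw.
  by apply: fin_bigcap_measurable => // k _; exact: ma.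
have -> : (fun w => h (mkseq (a^~ w) t)) =
    (fun w => \sum_(x : t.-tuple 'I_n) h x * \1_(F x) w).
  apply/funext => w; rewrite (bigD1 [tuple of mkseq (a^~ w) t]) //=.
  rewrite big1 ?addr0 => [|x xne]; last first.
    rewrite indicE memNset ?mulr0 // => Fw; case/eqP: xne.
    apply/val_inj/(@eq_from_nth _ x0); rewrite ?size_tuple // => i it.
    by rewrite nth_mkseq // Fw // mem_iota.
  rewrite indicE mem_set ?mulr1 // => k; rewrite mem_iota => /= kt.
  by rewrite nth_mkseq.
rewrite expectation_sum_indic // iid_mean_tuple; congr _%:E.
apply: eq_bigr => x _; rewrite mulrC; congr (_ * _).
rewrite /F (ind (iota 0 t) (nth x0 x)) ?iota_uniq //.
rewrite (eq_bigr (fun k => (rate G (nth x0 x k))%:E)) => [|k _]; last exact: Pa.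
rewrite prodEFin /=.
rewrite -[in RHS](mkseq_nth x0 x) size_tuple /mkseq big_map.
by [].
Qed.

End Prefix.

(** * The planning solution on the tree and its dual prices *)

Section GraphDist.
Context {n : nat} (e : rel 'I_n) (root : 'I_n).
Hypothesis conn : graph_connected e.
Local Notation D := (graph_dist e root).

Lemma graph_dist_le p : path e root p -> (D (last root p) <= size p)%N.
Proof.
move=> ep; rewrite leqNgt; apply/negP => lt.
have pn : (size p < n)%N.
  apply: leq_trans lt _; rewrite /graph_dist; apply: leq_trans (find_size _ _) _.
  by rewrite size_iota.
have := before_find 0 lt; rewrite nth_iota // add0n => /= /negbT /negP; apply.
by apply/existsP; exists (in_tuple p); rewrite /= ep eqxx.
Qed.

(** A walk shortened to a simple path has fewer than [n] edges, so the search over [iota 0 n]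
    succeeds. *)
Lemma graph_dist_path i :
  (D i < n)%N /\ exists p, [/\ path e root p, last root p = i & size p = D i].
Proof.
set a := fun k => [exists p : k.-tuple 'I_n, path e root p && (last root p == i)].
have ha : has a (iota 0 n).
  have /connectP[p0 ep0 ei] := conn root i. rewrite /a ei.
  case/shortenP: ep0 => p ep up _; apply/hasP; exists (size p).
    rewrite mem_iota /= add0n; have := card_uniqP up => /= <-.
    by rewrite -[X in (_ <= X)%N](card_ord n) max_card.
  by apply/existsP; exists (in_tuple p); rewrite /= ep eqxx.
have lt : (D i < n)%N by move: ha; rewrite has_find size_iota.
split=> //; have := nth_find 0 ha; rewrite nth_iota // add0n.
by rewrite /a => /existsP[p] /andP[ep /eqP pi]; exists p; rewrite size_tuple.
Qed.

Lemma graph_dist_lt i : (D i < n)%N.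
Proof. by have [] := graph_dist_path i. Qed.

Lemma graph_dist_root : D root = 0%N.
Proof. by apply/eqP; rewrite -leqn0; exact: (@graph_dist_le [::]). Qed.

Definition parent i := odflt root [pick j | e j i && (D i == (D j).+1)].

(** The penultimate vertex of a shortest walk from the root qualifies as parent. *)
Lemma parentP i : i != root -> e (parent i) i /\ D i = (D (parent i)).+1.
Proof.
move=> ir; rewrite /parent; case: pickP => [j /andP[ej /eqP dj] //|none].
have [_ [p [ep pi sp]]] := graph_dist_path i.
case/lastP: p ep pi sp => [|p j] ep.
  by move=> /= ri; rewrite -ri eqxx in ir.
rewrite last_rcons size_rcons => ji sp; move: ep; rewrite rcons_path ji.
case/andP=> ep el; have := none (last root p); rewrite el /= => /negP[].
rewrite eqn_leq; apply/andP; split; last by rewrite -sp ltnS graph_dist_le.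
have [_ [q [eq qi <-]]] := graph_dist_path (last root p).
have := @graph_dist_le (rcons q i); rewrite rcons_path eq qi el last_rcons.
by rewrite size_rcons => ->.
Qed.

Lemma graph_dist_parent i : i != root -> D i = (D (parent i)).+1.
Proof. by case/parentP. Qed.

End GraphDist.

(** * Active matches as tree edges, their flows and prices *)

Section StaticTree.
Context {R : realType} {n : nat} (G : matching_model R n).
Local Notation Mt := (match_type G).
Variables (z : Mt -> R) (s : 'I_n -> R) (root : 'I_n).
Hypothesis gpg : gpg_solution z s.
Hypothesis conn : graph_connected (match_adj z).
Hypothesis under : under_demanded s = [set root]%SET.

Local Notation D := (graph_dist (match_adj z) root).
Local Notation par := (parent (match_adj z) root).
Local Notation T := (child_sum root par).

Let dep_par i : i != root -> D i = (D (par i)).+1.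
Proof. exact: graph_dist_parent. Qed.

Let dep_lt i : (D i < n)%N.
Proof. exact: graph_dist_lt. Qed.

Lemma gpg_feasible : spp_feasible z s. Proof. by case: gpg => -[]. Qed.

Lemma flow_ge0 m : 0 <= z m. Proof. by case: gpg_feasible. Qed.

Lemma inactive_flow m : m \notin active_matches z -> z m = 0.
Proof.
rewrite inE -leNgt => h; apply/eqP; rewrite eq_le h; exact: flow_ge0.
Qed.

Lemma slack_gt0 i : (0 < s i) = (i == root).
Proof. by have /setP/(_ i) := under; rewrite !inE. Qed.

Lemma slack_eq0 i : i != root -> s i = 0.
Proof.
rewrite -slack_gt0 -leNgt => h; apply/eqP; rewrite eq_le h.
by have [_ _ ->] := gpg_feasible.
Qed.

(* Nondegeneracy makes the basis equal to the support of (z, s).             *)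
Lemma card_active : (#|active_matches z|).+1 = n.
Proof.
have [_ [B [Bb B0 B1]]] := gpg.
have EB : B = inr root |: [set inl m | m in active_matches z]%SET.
  apply/setP => v; have -> : (v \in B) = (spp_var z s v != 0).
    by apply/idP/idP => [/B1//|]; apply: contraNT => /B0/eqP.
  rewrite !inE; case: v => [m|i] /=.
    rewrite mem_imset ?inE; last by move=> ? ? [].
    by rewrite lt_def flow_ge0 andbT.
  rewrite (inj_eq (@inr_inj _ _)) -slack_gt0 lt_def.
  have [_ _ ->] := gpg_feasible; rewrite andbT.
  by case: imsetP => [[]//|]; rewrite orbF.
have := @size_basis _ _ _ _ (in_tuple _) Bb.
rewrite size_map -cardE dimvf dim_matrix mulr1 EB cardsU1.
rewrite card_imset; last by move=> ? ? [].
have -> /= : (inr root \notin [set inl m | m in active_matches z]%SET).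
  by apply/imsetP => -[].
by rewrite add1n => <-.
Qed.

Definition edge i := [pick m in active_matches z | ends m == [set i; par i]%SET].

Lemma edgeP i : i != root ->
  exists m, [/\ edge i = Some m, m \in active_matches z & ends m = [set i; par i]%SET].
Proof.
move=> ir; rewrite /edge; case: pickP => [m /andP[am /eqP em]|none].
  by exists m.
have [/existsP[m /andP[am /eqP em]] _] := parentP conn ir.
by have := none m; rewrite am em finset.setUC eqxx.
Qed.

Lemma edge_inj i j m : i != root -> j != root ->
  edge i = Some m -> edge j = Some m -> i = j.
Proof.
move=> ir jr ei ej; apply/eqP/negP => /negP ij.
have [m1 [+ _ e1]] := edgeP ir; rewrite ei => -[E1]; subst m1.
have [m1 [+ _ e2]] := edgeP jr; rewrite ej => -[E1]; subst m1.
have : i \in [set j; par j]%SET by rewrite -e2 e1 !inE eqxx.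
have : j \in [set i; par i]%SET by rewrite -e1 e2 !inE eqxx.
rewrite !inE eq_sym (negbTE ij) /= => /eqP ji /eqP ij'.
have := dep_par ir; have := dep_par jr; rewrite -ji -ij'; lia.
Qed.

(** Counting: [edge] is injective on the [n - 1] types other than the root, and there are exactly
    [n - 1] active matches. *)
Lemma edge_surj m : m \in active_matches z ->
  exists i, [/\ i != root, edge i = Some m & ends m = [set i; par i]%SET].
Proof.
move=> am; pose A := [set edge i | i in [set~ root]]%SET.
have sub : A \subset [set Some m | m in active_matches z]%SET.
  apply/fintype.subsetP => o /imsetP[i]; rewrite !inE => ir ->.
  by have [m' [-> am' _]] := edgeP ir; apply/imsetP; exists m'.
have cA : #|A| = n.-1.
  rewrite card_in_imset => [|i j]; first by rewrite cardsC1 card_ord.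
  rewrite !inE => ir jr eij; have [m' [ei _ _]] := edgeP ir.
  by apply: (edge_inj ir jr ei); rewrite -eij.
have : Some m \in A.
  have -> : A = [set Some m | m in active_matches z]%SET.
    apply/eqP; rewrite eqEcard sub /= card_imset; last by move=> ? ? [].
    by rewrite cA -[in leqRHS]card_active.
  by apply/imsetP; exists m.
case/imsetP => i; rewrite !inE => ir /esym ei; exists i; split=> //.
by have [m' [+ _ <-]] := edgeP ir; rewrite ei => -[->].
Qed.

(** Every active match joins a type to its parent, and depths fix the orientation. *)
Lemma is_childE i j : is_child (match_adj z) root i j = child root par i j.
Proof.
apply/andP/andP => [[/existsP[m /andP[am /eqP em]] /eqP dj]|[jr /eqP <-]].
  have [k [kr ek]] := edge_surj am; rewrite em => E.
  have dk := dep_par kr.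
  have : i \in [set k; par k]%SET by rewrite -E !inE eqxx.
  have : j \in [set k; par k]%SET by rewrite -E !inE eqxx orbT.
  rewrite !inE => /orP[]/eqP jk /orP[]/eqP ik; move: dj; rewrite jk ik.
  - by move/n_Sn.
  - by rewrite kr eqxx.
  - by rewrite dk => /eqP; rewrite ltn_eqF.
  by move/n_Sn.
by have [-> ->] := parentP conn jr.
Qed.

Definition edge_flow (g : 'I_n -> R) (m : Mt) : R :=
  \sum_(i | (i != root) && (edge i == Some m)) g i.

Lemma edge_flow_active g i m : i != root -> edge i = Some m ->
  edge_flow g m = g i.
Proof.
move=> ir ei; rewrite /edge_flow (big_pred1 i) // => j /=.
apply/andP/eqP => [[jr /eqP ej]|->]; last by rewrite ir ei.
exact: edge_inj ej ei.
Qed.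

Lemma edge_flow_inactive g m : m \notin active_matches z -> edge_flow g m = 0.
Proof.
move=> am; rewrite /edge_flow big_pred0 // => i; apply/negP => /andP[ir /eqP ei].
have [m' [+ am' _]] := edgeP ir; rewrite ei => -[E]; by rewrite -E (negbTE am) in am'.
Qed.

Lemma sum_edge_flow (F : Mt -> R) g :
  \sum_m F m * edge_flow g m = \sum_(i | i != root) oapp F 0 (edge i) * g i.
Proof.
rewrite /edge_flow; under eq_bigr do rewrite mulr_sumr.
rewrite (exchange_big_dep (fun i => i != root)) /=; last by move=> ? ? _ /andP[].
apply: eq_bigr => i ir; have [m [ei _ _]] := edgeP ir.
rewrite (big_pred1 m) => [|m'] /=; first by rewrite ei.
by rewrite ir ei (inj_eq Some_inj) eq_sym.
Qed.

(** On the tree the incidence matrix acts as [1 + T], short of the diagonal term at the root. *)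
Lemma incidence_edge_flow g i :
  \sum_(m | i \in ends m) edge_flow g m = (i != root)%:R * g i + T g i.
Proof.
transitivity (\sum_m (i \in ends m)%:R * edge_flow g m).
  rewrite big_mkcond; apply: eq_bigr => m _.
  by case: ifP => _; rewrite ?mul1r ?mul0r.
rewrite sum_edge_flow.
transitivity (\sum_(j | j != root) ((j == i)%:R * g j + (par j == i)%:R * g j)).
  apply: eq_bigr => j jr; have [m [-> _ /= ->]] := edgeP jr.
  rewrite !inE [i == j]eq_sym [i == par j]eq_sym -mulrDl; congr (_ * _).
  case: (j =P i) => [<-|]; last by rewrite add0r.
  case: (par j =P j) => [E|]; last by rewrite addr0.
  by have := dep_par jr; rewrite E => /n_Sn.
rewrite big_split /=; congr (_ + _).
  case: (boolP (i == root)) => [/eqP ->|ir].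
    by rewrite mul0r big1 // => j /negbTE ->; rewrite mul0r.
  by rewrite (bigD1 i) //= eqxx big1 ?addr0 // => j /andP[_ /negbTE ->]; rewrite mul0r.
rewrite /child_sum big_mkcondr /=; apply: eq_bigr => j _.
by case: ifP => _; rewrite ?mul1r ?mul0r.
Qed.

(** The slack of the root acts as a flow to a fictitious parent, so that [M z + s = lambda] reads
    [(1 + T) parent_flow = rate]. *)
Definition parent_flow i : R :=
  if i == root then s root else oapp z 0 (edge i).

Lemma edge_flow_parent m : edge_flow parent_flow m = z m.
Proof.
have [am|am] := boolP (m \in active_matches z); last first.
  by rewrite edge_flow_inactive // inactive_flow.
have [i [ir ei _]] := edge_surj am.
by rewrite (edge_flow_active _ ir ei) /parent_flow (negbTE ir) ei.
Qed.

Lemma parent_flowE i : parent_flow i + T parent_flow i = rate G i.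
Proof.
have [<- _ _] := gpg_feasible.
under eq_bigr do rewrite -edge_flow_parent.
rewrite incidence_edge_flow /parent_flow; case: (boolP (i == root)) => [/eqP ->|ir].
  by rewrite mul0r add0r addrC.
by rewrite mul1r (slack_eq0 ir) addr0.
Qed.

Local Notation eps := (gpg_eps z s).
Let values := ([set z m | m in [set m | 0 < z m]] `|`
       [set s i | i in [set i | 0 < s i]])%classic.

Lemma values_lbound0 : has_lbound values.
Proof. by exists 0 => _ [[m /= h <-]|[i /= h <-]]; exact: ltW. Qed.

Lemma gpg_eps_parent_flow i : eps <= parent_flow i.
Proof.
apply: ge_inf; first exact: values_lbound0.
rewrite /parent_flow; case: (boolP (i == root)) => [_|ir].
  by right; exists root => //=; rewrite slack_gt0.
have [m [-> am _]] := edgeP ir; left; exists m => //=.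
by move: am; rewrite inE.
Qed.

Lemma gpg_eps_gt0 : 0 < eps.
Proof.
(* An explicit finite minimum below the infimum; the default 1 covers the absence of active
   matches. *)
pose c := Num.min (\big[Num.min/1]_(m in active_matches z) z m) (s root).
apply: (@lt_le_trans _ _ c).
  rewrite lt_min slack_gt0 eqxx andbT.
  by elim/big_ind: _ => // [x y x0 y0|m]; [rewrite lt_min x0|rewrite inE].
apply: lb_le_inf; first by exists (s root); right; exists root => //=; rewrite slack_gt0.
move=> _ [[m /= h <-]|[i /= h <-]]; rewrite ge_min.
  by apply/orP; left; apply: bigmin_le_cond; rewrite inE.
by move: h; rewrite slack_gt0 => /eqP ->; rewrite lexx orbT.
Qed.

Lemma gpg_eps_le1 : eps <= 1.
Proof.
apply: le_trans (gpg_eps_parent_flow root) _.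
rewrite -(rate_sum1 G) (bigD1 root) //= -parent_flowE -addrA lerDl addr_ge0 //.
  apply: child_sum_ge0 => i; exact: le_trans (ltW gpg_eps_gt0) (gpg_eps_parent_flow i).
by apply: sumr_ge0 => i _; exact/ltW/rate_gt0.
Qed.

(** Prices by complementary slackness: 0 at the root, whose slack is positive, and summing to the
    reward over each active match. They are solved from the root down, the fuel being the depth. *)
Fixpoint dual_fuel (k : nat) (i : 'I_n) : R :=
  if k is k'.+1 then oapp (@reward _ _ G) 0 (edge i) - dual_fuel k' (par i) else 0.

Definition dual i := dual_fuel (D i) i.

Lemma dual_root : dual root = 0.
Proof. by rewrite /dual graph_dist_root. Qed.

Lemma dual_edge i : i != root ->
  dual i + dual (par i) = oapp (@reward _ _ G) 0 (edge i).
Proof. by move=> ir; rewrite /dual (dep_par ir) /= subrK. Qed.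

Lemma dual_active m : m \in active_matches z ->
  reward m = \sum_(i in ends m) dual i.
Proof.
move=> am; have [i [ir ei ->]] := edge_surj am.
have := dual_edge ir; rewrite ei /= => <-.
rewrite big_setU1 ?big_set1 // inE; apply/eqP => ii.
by have := dep_par ir; rewrite -ii => /n_Sn.
Qed.

(* Increase the nonbasic variables along (w, u) and let the basic ones       *)
(* compensate: nondegeneracy leaves room for a small step, so optimality     *)
(* bounds the gain of this direction.                                        *)
Lemma dual_price (w : Mt -> R) (u : 'I_n -> R) :
  (forall m, 0 <= w m) -> (forall i, 0 <= u i) ->
  \sum_m reward m * w m <=
    \sum_i dual i * (\sum_(m | i \in ends m) w m + u i).
Proof.
move=> w0 u0; set c := fun i => \sum_(m | i \in ends m) w m + u i.
pose f := alt_solve root par c.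
have fE i : f i + T f i = c i by exact: (alt_solveE dep_par dep_lt).
pose K := \sum_i `|f i|.
have fK i : f i <= K.
  by apply: le_trans (ler_norm _) _; rewrite /K (bigD1 i) //= lerDl sumr_ge0.
have K0 : 0 <= K by rewrite sumr_ge0.
(* This step size keeps each compensation [t * f i] at most [eps], hence at most every basic
   variable. *)
pose t := eps / (1 + K).
have t0 : 0 < t by rewrite divr_gt0 ?gpg_eps_gt0 // ltr_pwDl.
have tf i : t * f i <= eps.
  rewrite /t mulrAC ler_pdivrMr ?ltr_pwDl // ler_pM2l ?gpg_eps_gt0 //.
  by apply: le_trans (fK i) _; rewrite lerDr.
pose z' m := z m - t * edge_flow f m + t * w m.
pose s' i := s i - t * ((i == root)%:R * f i) + t * u i.
have feas : spp_feasible z' s'.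
  split=> [i|m|i].
  - rewrite /z' big_split sumrB /= -!mulr_sumr incidence_edge_flow.
    have [<- _ _] := gpg_feasible; have := congr1 (fun x => t * x) (fE i).
    rewrite /c /s' /=; case: (i == root) => /=; lra.
  - apply: addr_ge0; last by rewrite mulr_ge0 // ltW.
    rewrite subr_ge0.
    have [am|am] := boolP (m \in active_matches z); last first.
      by rewrite edge_flow_inactive // mulr0 flow_ge0.
    have [i [ir ei _]] := edge_surj am.
    rewrite (edge_flow_active _ ir ei); apply: le_trans (tf i) _.
    by rewrite -edge_flow_parent (edge_flow_active _ ir ei) gpg_eps_parent_flow.
  apply: addr_ge0; last by rewrite mulr_ge0 // ltW.
  rewrite subr_ge0.
  case: (boolP (i == root)) => [/eqP ->|ir] /=; last first.
    by rewrite mul0r mulr0; case: gpg_feasible.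
  rewrite mul1r; apply: le_trans (tf root) _.
  by have := gpg_eps_parent_flow root; rewrite /parent_flow eqxx.
have [[_ /(_ _ _ feas) opt] _] := gpg.
have gain : \sum_m reward m * w m <= \sum_m reward m * edge_flow f m.
  rewrite -(ler_pM2l t0) !mulr_sumr; under eq_bigr do rewrite mulrCA.
  under [leRHS]eq_bigr do rewrite mulrCA.
  have E : \sum_m reward m * z' m = \sum_m reward m * z m -
      \sum_m reward m * (t * edge_flow f m) + \sum_m reward m * (t * w m).
    by rewrite -sumrB -big_split; apply: eq_bigr => m _ /=; rewrite /z'; ring.
  move: opt; rewrite E; lra.
(* Summation by parts along the tree turns rewards times [f] into prices times [f + T f = c]. *)
apply: le_trans gain _; rewrite sum_edge_flow.
under eq_bigr => i ir do rewrite -(dual_edge ir) mulrDl.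
rewrite big_split /= -(sum_child_sum root par (fun i => dual (par i) * f i)).
rewrite [leRHS](eq_bigr (fun i => dual i * f i + dual i * T f i)); last first.
  by move=> i _; rewrite -mulrDr fE.
rewrite [leRHS]big_split /= [X in _ <= X + _](bigD1 root) //= dual_root mul0r add0r.
rewrite lerD2l; apply: ler_sum => p _; rewrite /child_sum mulr_sumr.
by apply: ler_sum => i /andP[_ /eqP ->].
Qed.

(** Raising the slack of [i] alone earns no reward, so [dual_price] applies with gain 0. *)
Lemma dual_ge0 i : 0 <= dual i.
Proof.
have := @dual_price (fun=> 0) (unit_at i) (fun=> lexx 0) (fun=> ler0n _ _).
rewrite big1 => [|m _]; last by rewrite mulr0.
rewrite (eq_bigr (fun j => dual j * unit_at i j)) => [|j _]; last first.
  by rewrite big1 ?add0r.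
rewrite (bigD1 i) //= big1 => [|j /negbTE ji]; rewrite /unit_at ?ji ?mulr0 //.
by rewrite eqxx mulr1 addr0.
Qed.

Lemma reward_le_dual (m : Mt) : reward m <= \sum_(i in ends m) dual i.
Proof.
have := @dual_price (fun m' => (m' == m)%:R) (fun=> 0) (fun=> ler0n _ _) (fun=> lexx 0).
rewrite (bigD1 m) //= eqxx mulr1 big1 ?addr0 => [|m' /negbTE ->]; last by rewrite mulr0.
move/le_trans; apply; rewrite [leRHS]big_mkcond; apply: ler_sum => i _.
rewrite addr0; case: ifP => im.
  rewrite (bigD1 m) //= eqxx big1 ?addr0 ?mulr1 // => m' /andP[_ /negbTE ->] //.
rewrite big1 ?mulr0 // => m' im'; case: eqP => // E.
by rewrite E im in im'.
Qed.

(** As the parent's price is nonnegative, a price is at most the reward of the parent edge. The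
    squared depth is at least 1 once a type other than the root exists; the root has price 0. *)
Lemma dual_le i :
  dual i <= max_reward z * (tree_depth (match_adj z) root)%:R ^+ 2.
Proof.
have mr0 : 0 <= max_reward z.
  rewrite /max_reward; elim/big_ind: _ => // [x y x0 _|m _].
    by rewrite le_max x0.
  exact/ltW/reward_gt0.
have [->|ir] := eqVneq i root; first by rewrite dual_root mulr_ge0 ?sqr_ge0.
have dr : (1 <= tree_depth (match_adj z) root)%N.
  by apply: leq_trans (leq_bigmax i); rewrite (dep_par ir).
apply: (@le_trans _ _ (max_reward z)).
  have [m [ei am _]] := edgeP ir.
  apply: (@le_trans _ _ (reward m)); last exact: le_bigmax_cond.
  by have := dual_edge ir; rewrite ei /= => <-; rewrite lerDl dual_ge0.
by rewrite ler_peMr // exprn_ege1 // ler1n.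
Qed.

End StaticTree.

(** * The tree priority policy *)

Section Dynamics.
Context {R : realType} {n : nat} (G : matching_model R n).
Local Notation Mt := (match_type G).
Variable pi : static_policy G.

(** Take the element of [B] that beats the most others in [B]: anything above it would beat strictly
    more. *)
Lemma strict_order_max (A B : {set Mt}) (o : rel Mt) :
  strict_order_on A o -> B \subset A -> B != finset.set0 ->
  exists2 m, m \in B & forall m', m' \in B -> m' != m -> o m m'.
Proof.
move=> [irr tr tot] /fintype.subsetP BA /set0Pn[m0 Bm0].
pose N m := #|[set x in B | o m x]%SET|.
case: (@arg_maxnP _ m0 (mem B) N Bm0) => m Bm mmax.
have {}Bm : m \in B := Bm.
exists m => // m' Bm' mm'.
case/orP: (tot _ _ (BA _ Bm') (BA _ Bm) mm') => // om'm.
have : (N m' <= N m)%N := mmax m' Bm'.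
rewrite leqNgt => /negP[].
apply: proper_card; apply/properP; split.
  apply/fintype.subsetP => x; rewrite !inE => /andP[Bx omx]; rewrite Bx /=.
  exact: (tr m m' x (BA _ Bm) (BA _ Bm') (BA _ Bx)).
by exists m; rewrite !inE Bm //= (negbTE (irr _ (BA _ Bm))).
Qed.

Lemma highest_matchP Q i :
  strict_order_on (sp_matches pi i) (sp_order pi i) ->
  match highest_match pi Q i with
  | Some m => m \in sp_matches pi i /\ available Q i m
  | None => forall m, m \in sp_matches pi i -> ~~ available Q i m
  end.
Proof.
move=> so; rewrite /highest_match.
case: pickP => [m /andP[mi /andP[av _]] //|none m mi]; apply/negP => av.
pose B := [set m in sp_matches pi i | available Q i m]%SET.
have BA : B \subset sp_matches pi i.
  by apply/fintype.subsetP => x; rewrite inE => /andP[].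
have B0 : B != finset.set0 by apply/set0Pn; exists m; rewrite inE mi.
have [m1 + h] := strict_order_max so BA B0; rewrite inE => /andP[m1i av1].
have := none m1; rewrite m1i av1 /= => /negP; apply.
apply/forallP => m2; apply/implyP => m2i; apply/implyP => /andP[av2 ne].
by apply: h => //; rewrite inE m2i.
Qed.

Definition run (s : seq 'I_n) : state G := foldl (step pi) (init_state G) s.

Lemma run_rcons s i : run (rcons s i) = step pi (run s) i.
Proof. by rewrite /run foldl_rcons. Qed.

Lemma state_at_run a t : state_at pi a t = run (mkseq a t).
Proof. by elim: t => //= t IH; rewrite mkseqS run_rcons IH. Qed.

Definition collected (S : state G) : R :=
  \sum_m reward m * (performed S m)%:R.

Definition queues (S : state G) (i : 'I_n) : R := (queue S i)%:R.

Lemma queues_ge0 S i : 0 <= queues S i.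
Proof. by rewrite /queues ler0n. Qed.

Lemma arrivals_nth (x0 : 'I_n) (a : nat -> 'I_n) t :
  arrivals (nth x0 (mkseq a t)) t = arrivals a t.
Proof.
by apply/funext => i; apply: eq_bigr => k _; rewrite nth_mkseq.
Qed.

Lemma sum_arrivals (f : 'I_n -> R) a t :
  \sum_i f i * (arrivals a t i)%:R = \sum_(i <- mkseq a t) f i.
Proof.
have it : iota 0 t = index_iota 0 t by rewrite /index_iota subn0.
rewrite /mkseq big_map it big_mkord.
under eq_bigr do rewrite /arrivals natr_sum mulr_sumr.
rewrite exchange_big /=; apply: eq_bigr => k _.
rewrite (bigD1 (a k)) //= eqxx mulr1 big1 ?addr0 // => i ik.
by rewrite eq_sym (negbTE ik) mulr0.
Qed.

(** Weak duality: feasible prices charge every offline matching to the arrivals. *)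
Lemma offline_reward_le (p : 'I_n -> R) a t :
  (forall m : Mt, reward m <= \sum_(i in ends m) p i) -> (forall i, 0 <= p i) ->
  offline_reward G a t <= \sum_(i <- mkseq a t) p i.
Proof.
move=> rp p0; rewrite -sum_arrivals; apply: ge_sup.
  exists (\sum_(m : Mt) reward m * 0%:R), (fun=> 0%N) => //= i.
  by rewrite big1.
move=> _ [y /= hy <-].
apply: (@le_trans _ _ (\sum_m (\sum_(i in ends m) p i) * (y m)%:R)).
  by apply: ler_sum => m _; apply: ler_wpM2r.
under [leLHS]eq_bigr do rewrite mulr_suml.
rewrite (exchange_big_dep predT) //=; apply: ler_sum => i _.
by rewrite -mulr_sumr -natr_sum ler_wpM2l // ler_nat.
Qed.

(** * Reward accounting and flow bounds along a run of the policy *)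

Section TreePolicy.
Variables (z : Mt -> R) (s : 'I_n -> R) (root : 'I_n).
Hypothesis gpg : gpg_solution z s.
Hypothesis conn : graph_connected (match_adj z).
Hypothesis under : under_demanded s = [set root]%SET.
Hypothesis ttp : truncated_tree_priority z root pi.

Local Notation D := (graph_dist (match_adj z) root).
Local Notation par := (parent (match_adj z) root).
Local Notation T := (child_sum root par).
Local Notation dual := (dual z root).
Local Notation eps := (gpg_eps z s).

Let dep_par i : i != root -> D i = (D (par i)).+1.
Proof. exact: graph_dist_parent. Qed.

Let dep_lt i : (D i < n)%N.
Proof. exact: graph_dist_lt. Qed.

Lemma ttp_matchE i m : m \in sp_matches pi i ->
  exists c, [/\ child root par i c, m \in active_matches z,
    ends m = [set i; c]%SET & (ends m :\ i = [set c])%SET].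
Proof.
have [_ _ ->] := ttp; rewrite inE => /andP[am /existsP[c]].
rewrite (is_childE gpg conn under) => /andP[ic /eqP em]; exists c; split=> //.
apply/setP => x; rewrite em !inE; case: (x =P i) => [->|] //=.
by apply/esym/eqP => E; move: ic; rewrite -E (child_irrefl dep_par).
Qed.

Lemma ttp_child_match i c : child root par i c ->
  exists m, m \in sp_matches pi i /\ (ends m :\ i = [set c])%SET.
Proof.
move=> ic; have /andP[cr /eqP pc] := ic.
have [m [_ am em]] := edgeP conn cr.
have mi : m \in sp_matches pi i.
  have [_ _ ->] := ttp; rewrite inE am /=; apply/existsP; exists c.
  by rewrite (is_childE gpg conn under) ic em pc finset.setUC /=.
exists m; split=> //; have [c' [ic' _ + ->]] := ttp_matchE mi.
rewrite em pc => E; congr [set _]%SET.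
have : c \in [set i; c']%SET by rewrite -E !inE eqxx.
rewrite !inE => /orP[/eqP ci|/eqP //].
by move: ic; rewrite ci (child_irrefl dep_par).
Qed.

(** A match with a waiting child [c] earns [dual i + dual c] and removes [c]; a joining agent brings
    its price into the queues; a discarded root agent has price 0. *)
Lemma step_spec S i :
  tree_step root par (queues S) i (queues (step pi S i)) /\
  collected (step pi S i) + \sum_j dual j * queues (step pi S i) j =
  collected S + \sum_j dual j * queues S j + dual i.
Proof.
have [/(_ i)[_ _ so] trunc _] := ttp.
have := highest_matchP (queue S) so; rewrite /step.
case: highest_match => [m|none].
  case=> mi av; have [c [ic am em emi]] := ttp_matchE mi.
  have Qc : (0 < queue S c)%N.
    by have /forallP/(_ c) := av; rewrite emi inE eqxx.
  set S' := State _ _.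
  have qE : queues S' = queues S \- unit_at c.
    apply/funext => j; rewrite /queues /S' /= emi inE /unit_at natrB //.
    by case: eqP => [->|].
  split; first exact: (StepMatch ic qE).
  have -> : collected S' = collected S + reward m.
    rewrite /collected /S' /=; under eq_bigr do rewrite natrD mulrDr.
    rewrite big_split /=; congr (_ + _).
    by rewrite (bigD1 m) //= eqxx mulr1 big1 ?addr0 // => m' /negbTE ->; rewrite mulr0.
  have -> : \sum_j dual j * queues S' j = \sum_j dual j * queues S j - dual c.
    rewrite qE /=; under eq_bigr do rewrite mulrBr.
    rewrite sumrB; congr (_ - _); rewrite (bigD1 c) //= /unit_at eqxx mulr1.
    by rewrite big1 ?addr0 // => j /negbTE ->; rewrite mulr0.
  rewrite (dual_active gpg conn under am) em big_setU1 ?big_set1 /=; first lra.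
  by rewrite inE; apply/eqP => E; move: ic; rewrite E (child_irrefl dep_par).
have empty c : child root par i c -> queues S c = 0.
  move=> ic; have [m [mi emi]] := ttp_child_match ic.
  have := none m mi; rewrite /available => /forallPn[j]; rewrite emi inE.
  by rewrite negb_imply => /andP[/eqP ->]; rewrite -eqn0Ngt /queues => /eqP ->.
rewrite trunc inE; case: (boolP (i == root)) => ir /=.
  split; last by rewrite (eqP ir) (dual_root z root) addr0.
  apply: StepJoin empty _; rewrite ir /=; apply/funext => j /=.
  by rewrite mul0r addr0.
set S' := State _ _.
have qE : queues S' = queues S \+ (fun p => (i != root)%:R * unit_at i p).
  by apply/funext => j; rewrite /queues /S' /= ir natrD mul1r.
split; first exact: StepJoin empty qE.
rewrite -addrA; congr (_ + _).
rewrite qE ir /=; under eq_bigr do rewrite mul1r mulrDr.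
rewrite big_split /=; congr (_ + _); rewrite (bigD1 i) //= /unit_at eqxx mulr1.
by rewrite big1 ?addr0 // => j /negbTE ->; rewrite mulr0.
Qed.

Lemma collected_run u :
  collected (run u) + \sum_j dual j * queues (run u) j = \sum_(i <- u) dual i.
Proof.
elim/last_ind: u => [|u i IH].
  rewrite big_nil /collected /queues /=.
  by rewrite !big1 ?addr0 // => j _; rewrite mulr0.
rewrite run_rcons big_rcons /= -IH addrC.
by have [_ ->] := step_spec (run u) i; rewrite addrC.
Qed.

(** Chosen so that [margin * n = eps] is at most every parent flow, as the flow bound requires. *)
Definition margin : R := eps / n%:R.

Definition centered_step (q i : 'I_n) : R :=
  walk_step root par (rate G) margin i q.

Let n_gt0 : (0 : R) < n%:R. Proof. by rewrite ltr0n; case: (n) root => [[]|]. Qed.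

Lemma margin_gt0 : 0 < margin.
Proof. by rewrite divr_gt0 // (gpg_eps_gt0 z under). Qed.

Lemma net_flow_run u p :
  net_flow root par (queues (run u)) p <=
  even_sum root par (fun q => lindley (centered_step q) u) p.
Proof.
elim/last_ind: u p => [|u i IH] p.
  have -> : net_flow root par (queues (run [::])) p = 0.
    apply: (alt_uniq dep_par dep_lt) => j.
    rewrite (net_flowE dep_par dep_lt) /child_sum.
    by rewrite big1.
  apply: (even_sum_ge0 dep_par dep_lt) => j; exact: lindley_ge0.
rewrite run_rcons.
apply: (@net_flow_le_step _ _ _ _ _ dep_par dep_lt (rate G) (parent_flow z s root) margin
  _ _ _ i (queues (run u)) _ (fun q => lindley (centered_step q) u)) => //.
- exact: ltW margin_gt0.
- exact: parent_flowE gpg conn under.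
- move=> j; rewrite /margin divfK ?gt_eqF //.
  exact: gpg_eps_parent_flow conn under j.
- by have [] := step_spec (run u) i.
- by move=> j; exact: lindley_ge0.
by move=> j; rewrite lindley_rcons le_max lexx orbT.
Qed.

(** Both rewards are compared with the total price of the arrivals; the gap is at most the price of
    the waiting agents. *)
Lemma offline_gap_le x0 t u : size u = t ->
  offline_reward G (nth x0 u) t - collected (run u) <=
  max_reward z * (tree_depth (match_adj z) root)%:R ^+ 2 *
  (n%:R * \sum_q lindley (centered_step q) u).
Proof.
move=> ut.
have := @offline_reward_le dual (nth x0 u) t (reward_le_dual gpg conn under)
  (dual_ge0 gpg conn under).
have -> : mkseq (nth x0 u) t = u by rewrite -ut mkseq_nth.
rewrite -collected_run => h.
apply: (@le_trans _ _ (\sum_j dual j * queues (run u) j)); first by move: h; lra.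
set K := max_reward z * _.
apply: (@le_trans _ _ (K * \sum_(j | j != root) queues (run u) j)).
  rewrite (bigD1 root) //= (dual_root z root) mul0r add0r mulr_sumr.
  apply: ler_sum => j _; apply: ler_wpM2r; first exact: queues_ge0.
  exact: (dual_le gpg conn under).
apply: ler_wpM2l.
  by rewrite -(dual_root z root) (dual_le gpg conn under).
apply: (sum_queue_le dep_par dep_lt) => [j|j|p]; first exact: queues_ge0.
  exact: lindley_ge0.
exact: net_flow_run.
Qed.

Lemma sum_rate_child q : \sum_i rate G i * (child root par q i)%:R = T (rate G) q.
Proof.
rewrite /child_sum [RHS]big_mkcond; apply: eq_bigr => i _.
by case: ifP => _; rewrite ?mulr1 ?mulr0.
Qed.

Lemma sum_rate_unit q : \sum_i rate G i * unit_at i q = rate G q.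
Proof.
rewrite (bigD1 q) //= /unit_at eqxx mulr1 big1 ?addr0 // => i iq.
by rewrite eq_sym (negbTE iq) mulr0.
Qed.

Lemma centered_step_mean q :
  \sum_i rate G i * centered_step q i = - margin.
Proof.
rewrite /centered_step /walk_step.
under eq_bigr do rewrite child_sum_unit !mulrBr.
rewrite !sumrB -!mulr_suml rate_sum1 !mul1r.
rewrite sum_rate_child sum_rate_unit.
lra.
Qed.

(** No type is its own child, so the uncentered increment is 1, -1 or 0 and its square is a sum of
    two indicators. *)
Lemma centered_step_var q :
  \sum_i rate G i * centered_step q i ^+ 2 <=
  T (rate G) q + rate G q + margin ^+ 2.
Proof.
set c := T (rate G) q - rate G q + margin.
have E i : rate G i * centered_step q i ^+ 2 =
    rate G i * (child root par q i)%:R + rate G i * unit_at i q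
    - 2 * c * (rate G i * centered_step q i) - c ^+ 2 * rate G i.
  rewrite /centered_step /walk_step child_sum_unit /unit_at.
  have : ~~ (child root par q i && (q == i)).
    by apply/negP => /andP[+ /eqP E]; rewrite E (child_irrefl dep_par).
  by case: child; case: eqP => //= _ _; rewrite /c; ring.
under eq_bigr do rewrite E.
rewrite !sumrB big_split /= -!mulr_sumr centered_step_mean rate_sum1.
rewrite sum_rate_child sum_rate_unit.
have := sqr_ge0 (T (rate G) q - rate G q).
rewrite /c; lra.
Qed.

(** The constant 3 arises because each of the three terms of the variance bound sums to at most 1
    over all types. *)
Lemma sum_lindley_mean t :
  \sum_q iid_mean (rate G) t (lindley (centered_step q)) <= 3 * n%:R / eps.
Proof.
have e0 := gpg_eps_gt0 z under.
have -> : 3 * n%:R / eps = 3 / margin by rewrite /margin invf_div mulrA.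
rewrite ler_pdivlMr ?margin_gt0 // mulrC mulr_sumr.
apply: (@le_trans _ _ (\sum_q (T (rate G) q + rate G q + margin ^+ 2))).
  apply: ler_sum => q _; apply: le_trans (centered_step_var q).
  apply: lindley_mean_le => //.
  - by move=> i; exact/ltW/rate_gt0.
  - exact: rate_sum1.
  - exact: ltW margin_gt0.
  exact: centered_step_mean.
rewrite !big_split /= rate_sum1 sum_child_sum sumr_const card_ord.
have h1 : \sum_(i | i != root) rate G i <= 1.
  by rewrite -(rate_sum1 G) [leRHS](bigD1 root) //= lerDr ltW ?rate_gt0.
have h2 : margin ^+ 2 *+ n <= 1.
  rewrite -mulr_natr expr2 -mulrA {2}/margin divfK ?gt_eqF //.
  have n1 : (1 : R) <= n%:R by rewrite ler1n -(@ltr0n R).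
  have e1 := gpg_eps_le1 gpg conn under.
  apply: mulr_ile1 => //; rewrite ?(ltW margin_gt0) ?(ltW e0) //.
  by rewrite /margin ler_pdivrMr // mul1r (le_trans e1).
lra.
Qed.

End TreePolicy.
End Dynamics.

(** * Assembly of the regret bound *)

Theorem mainTheorem3 (R : realType) :
  exists C : R, 0 < C /\
  forall (n : nat) (G : matching_model R n)
         (z : match_type G -> R) (s : 'I_n -> R),
    gpg_solution z s ->
    is_tree (match_adj z) ->
  forall root : 'I_n,
    under_demanded s = [set root]%SET ->
  forall pi : static_policy G,
    truncated_tree_priority z root pi ->
  forall (d : measure_display) (Omega : measurableType d)
         (P : probability Omega R) (a : nat -> Omega -> 'I_n),
    iid_arrivals G P a ->
  forall T : nat, (1 <= T)%N ->
    (regret P a pi T <=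
      (C * max_reward z *
        (n%:R ^+ 2 * (tree_depth (match_adj z) root)%:R ^+ 2 /
         gpg_eps z s))%:E)%E.
Proof.
(* 3 bounds the total variance; one factor [n] comes from summing over types in [sum_queue_le], the
   other from the margin [eps / n]. *)
exists 3; split=> // n G z s gpg [conn _] root under pi ttp d Omega P a ia T _.
apply: ge_ereal_sup => _ [t /= _ <-].
(* Both rewards at time [t] depend only on the word of the first [t] arrivals; [root] is the default
   value of [nth]. *)
have -> : (fun w => offline_reward G (a^~ w) t) =
    (fun w => offline_reward G (nth root (mkseq (a^~ w) t)) t).
  by apply/funext => w; rewrite /offline_reward arrivals_nth.
have -> : (fun w => online_reward pi (a^~ w) t) =
    (fun w => collected (run pi (mkseq (a^~ w) t))).
  by apply/funext => w; rewrite /online_reward state_at_run.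
rewrite (expectation_prefix ia t (fun u => offline_reward G (nth root u) t) root).
rewrite (expectation_prefix ia t (fun u => collected (run pi u)) root).
rewrite -EFinB lee_fin -mulN1r -iid_meanZ -iid_meanD.
have r0 i : 0 <= rate G i by exact/ltW/rate_gt0.
set K := max_reward z * (tree_depth (match_adj z) root)%:R ^+ 2.
apply: (@le_trans _ _ (iid_mean (rate G) t
    (fun u => K * (n%:R * \sum_q lindley (centered_step z s root q) u)))).
  apply: le_iid_mean => // u ut; rewrite mulN1r.
  exact: (offline_gap_le gpg conn under ttp root ut).
rewrite 2!iid_meanZ iid_mean_sum.
have K0 : 0 <= K by rewrite -(dual_root z root) (dual_le gpg conn under).
have -> : 3 * max_reward z *
    (n%:R ^+ 2 * (tree_depth (match_adj z) root)%:R ^+ 2 / gpg_eps z s) =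
    K * (n%:R * (3 * n%:R / gpg_eps z s)).
  by rewrite /K; ring.
by rewrite !ler_wpM2l // (sum_lindley_mean gpg conn under).
Qed.
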